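(* Let $k_o\ge1$ be an integer and, for every $n$, let $\mathcal{V}_n\subset\mathcal{S}_n^V$ and, for $v\in\mathcal{V}_n$, let $\mathcal{U}_n(v)\subset\mathcal{S}_n(v)$ be a lattice of span $k_o$, i.e. $\mathcal{U}_n(v)=\{u_o+k_o,u_o+2k_o,\dots,u_o+mk_o\}$ for some integers $u_o$ and $m\ge1$ (depending on $n$ and $v$). Assume that for every $n$ there is a random transformation $\mathcal{R}$ of $\mathcal{X}_n\times\mathcal{X}_n$ (with $\tilde Z:=\mathcal{R}(Z)$) such that, with constants $\alpha>0$, $\epsilon_o>0$, $A<\infty$ not depending on $n$, the following hold for every $n$: (A1) $P\big(E[L(\tilde Z)-L(Z)\mid Z]\ge\epsilon_o\big)\ge 1-\exp[-n^{\alpha}]$; (A2) $L(\tilde Z)-L(Z)\ge -A$; (A3) for any $(u,v)$ with $v\in\mathcal{V}_n$ and $u\in\mathcal{U}_n(v)$: if $Z\sim P_{(u,v)}$, then $\tilde Z\sim P_{(u+k_o,v)}$ (in particular $(u+k_o,v)\in\mathcal{S}_n$). Suppose moreover that there is a constant $a>0$, not depending on $n$, such that for every $n$ and any $(u,v)$ with $v\in\mathcal{V}_n$ and $u\in\mathcal{U}_n(v)$, $$P(U=u,V=v)\ge\frac{1}{an}.$$ Then there exists $n_5<\infty$ such that for every $n>n_5$, for every $v\in\mathcal{V}_n$ and all $u_1,u_2\in\mathcal{U}_n(v)$ with $u_1<u_2$, $$l(u_2,v)-l(u_1,v)\ge\frac{\epsilon_o}{2}.$$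
   Context: Let $\mathbb{A}$ be a finite alphabet and, for every $n\ge1$, $\mathcal{X}_n\subseteq\mathbb{A}^n$. $X=(X_1,\dots,X_n)$ and $Y=(Y_1,\dots,Y_n)$ are independent, identically distributed random sequences with sample space $\mathcal{X}_n$, and $Z:=(X,Y)$ (dependence on $n$ is suppressed). Score: let $S:\mathbb{A}\times\mathbb{A}\to\mathbb{R}^+$ be a pairwise scoring function (nonnegative values) and $\gamma\in\mathbb{R}$ a gap price. An alignment is a pair $(\rho,\tau)$ of increasing integer sequences $1\le\rho_1<\dots<\rho_k\le n$, $1\le\tau_1<\dots<\tau_k\le n$ of the same length $k$ (with $0\le k\le n$). Its score is $\sum_{i=1}^kS(X_{\rho_i},Y_{\tau_i})+\gamma(n-k)$, and the optimal score $L(Z)=L(X,Y)$ is the maximum over all alignments. Auxiliary variables: for each $n$ let $\mathfrak{u}:\mathcal{X}_n\times\mathcal{X}_n\to\mathbb{Z}$ and $\mathfrak{v}:\mathcal{X}_n\times\mathcal{X}_n\to\mathbb{Z}^d$ be functions, $U:=\mathfrak{u}(Z)$, $V:=\mathfrak{v}(Z)$. Let $\mathcal{S}_n,\mathcal{S}_n^U,\mathcal{S}_n^V$ be the supports of $(U,V)$, $U$, $V$. For $v\in\mathcal{S}_n^V$ let $\mathcal{S}_n(v):=\{u\in\mathcal{S}_n^U:(u,v)\in\mathcal{S}_n\}$. For $(u,v)\in\mathcal{S}_n$ let $l(u,v):=E[L(Z)\mid U=u,V=v]$ and let $P_{(u,v)}$ be the conditional law of $Z$ given $U=u,V=v$: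 $P_{(u,v)}(z)=P(Z=z\mid U=u,V=v)$. A random transformation is a random mapping $\mathcal{R}:\mathcal{X}_n\times\mathcal{X}_n\to\mathcal{X}_n\times\mathcal{X}_n$ whose randomness is independent of $Z$ (equivalently, a Markov kernel applied to $Z$). ''If $Z\sim P_{(u,v)}$ then $\tilde Z\sim Q$'' means that applying $\mathcal{R}$ (with independent randomness) to a random element with law $P_{(u,v)}$ gives a random element with law $Q$. *)

(* Defs.v *)
From HB Require Import structures.
From mathcomp Require Import all_boot all_order all_algebra.
From mathcomp Require Import all_classical all_reals all_analysis.

Set Implicit Arguments.
Unset Strict Implicit.
Unset Printing Implicit Defensive.

Import Order.TTheory GRing.Theory Num.Theory.
Local Open Scope classical_set_scope.
Local Open Scope ring_scope.

(* Every random object here takes values in a finite type, so a law on T is a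
   mass function T -> R and random variables are functions on T. *)

Section FiniteProbability.
Variables (R : realType) (T : finType).
Implicit Types (p : T -> R) (E : pred T) (f : T -> R).

Definition is_law p : Prop := (forall t, 0 <= p t) /\ \sum_t p t = 1.

Definition Pr p E : R := \sum_(t | E t) p t.

Definition Ex p f : R := \sum_t p t * f t.

(* Conditioning on a null event gives 0, since division by 0 is 0. *)
Definition cond_law p E : T -> R :=
  fun t => (if E t then p t else 0) / Pr p E.

Definition Ex_given p f E : R := Ex (cond_law p E) f.

(* The random variable E[f | g]. *)
Definition cond_Ex (T' : eqType) p f (g : T -> T') : T -> R :=
  fun t => Ex_given p f [pred s | g s == g t].

(* A random transformation with randomness independent of its argument is a
   Markov kernel: [K z] is the law of the image of [z]. *)
Definition is_kernel (K : T -> T -> R) : Prop := forall z, is_law (K z).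

(* Law of (Z, K(Z)) when Z ~ p. *)
Definition joint_law p (K : T -> T -> R) : T * T -> R :=
  fun zz => p zz.1 * K zz.1 zz.2.

(* Law of K(Z) when Z ~ p. *)
Definition transform_law p (K : T -> T -> R) : T -> R :=
  fun z' => \sum_z p z * K z z'.

(* Law of a pair of independent variables, both with law p. *)
Definition iid_pair p : T * T -> R := fun z => p z.1 * p z.2.

End FiniteProbability.

Section Alignment.
Variables (R : realType) (A : finType) (S : A -> A -> R) (gamma : R) (n : nat).

(* Positions are 0-based: 'I_n stands for {1, ..., n}. *)
Definition increasing (k : nat) (r : k.-tuple 'I_n) : bool :=
  sorted (fun i j : 'I_n => (i < j)%N) r.

Definition align_score (x y : n.-tuple A) (k : nat) (rho tau : k.-tuple 'I_n) : R :=
  \sum_(i < k) S (tnth x (tnth rho i)) (tnth y (tnth tau i))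
  + gamma * (n%:R - k%:R).

(* The default value of the maxima is the score of the empty alignment, which
   is itself one of the alignments (k = 0); a default of 0 would be wrong when
   all the scores are negative. *)
Definition opt_score (x y : n.-tuple A) : R :=
  let s0 := align_score x y [tuple] [tuple] in
  \big[Num.max/s0]_(k < n.+1)
    \big[Num.max/s0]_(rt : k.-tuple 'I_n * k.-tuple 'I_n
                        | increasing rt.1 && increasing rt.2)
      align_score x y rt.1 rt.2.

End Alignment.

Section Model.
Variables (R : realType) (A : finType) (n : nat).

Definition seqs (X : {set n.-tuple A}) : finType := {x : n.-tuple A | x \in X}.

Definition pairs (X : {set n.-tuple A}) : finType := (seqs X * seqs X)%type.

Definition Lscore (S : A -> A -> R) (gamma : R) (X : {set n.-tuple A})
    (z : pairs X) : R :=
  opt_score S gamma (val z.1) (val z.2).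

End Model.

Section Auxiliary.
Variables (R : realType) (d : nat) (W : finType).
Variables (P : W -> R) (U : W -> int) (V : W -> 'rV[int]_d).

Definition evUV (u : int) (v : 'rV[int]_d) : pred W :=
  [pred z | (U z == u) && (V z == v)].

Definition suppUV : set (int * 'rV[int]_d) :=
  [set uv | 0 < Pr P (evUV uv.1 uv.2)].

Definition suppU : set int := [set u | 0 < Pr P [pred z | U z == u]].

Definition suppV : set 'rV[int]_d := [set v | 0 < Pr P [pred z | V z == v]].

Definition fiberU (v : 'rV[int]_d) : set int :=
  [set u | suppU u /\ suppUV (u, v)].

Definition lawUV (u : int) (v : 'rV[int]_d) : W -> R := cond_law P (evUV u v).

Definition meanUV (f : W -> R) (u : int) (v : 'rV[int]_d) : R :=
  Ex_given P f (evUV u v).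

End Auxiliary.

Definition is_lattice (k : nat) (B : set int) : Prop :=
  exists (u0 : int) (m : nat), (1 <= m)%N /\
    B = [set u | exists i : nat, (1 <= i <= m)%N /\ u = u0 + (i * k)%N%:Z].

Section Transformation.
Variables (R : realType) (W : finType) (P : W -> R) (K : W -> W -> R).
Variable (L : W -> R).

(* On W * W with the law [joint_law P K], the first coordinate is Z and the
   second one is its random transform. *)

Definition score_gain (zz : W * W) : R := L zz.2 - L zz.1.

Definition condA1 (n : nat) (alpha eps : R) : Prop :=
  Pr (joint_law P K)
     [pred zz | eps <= cond_Ex (joint_law P K) score_gain fst zz]
  >= 1 - expR (- (n%:R `^ alpha)).

(* The bound holds almost surely. *)
Definition condA2 (C : R) : Prop :=
  forall zz : W * W, 0 < joint_law P K zz -> - C <= score_gain zz.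

Definition condA3 (d : nat) (U : W -> int) (V : W -> 'rV[int]_d) (k : nat)
    (Vs : set 'rV[int]_d) (Us : 'rV[int]_d -> set int) : Prop :=
  forall (v : 'rV[int]_d) (u : int), Vs v -> Us v u ->
    suppUV P U V (u + k%:Z, v) /\
    transform_law (lawUV P U V u v) K =1 lawUV P U V (u + k%:Z) v.

End Transformation.

(* Main.v *)
Require Import Defs.
From mathcomp Require Import all_boot all_order all_algebra.
From mathcomp Require Import all_classical all_reals all_analysis.
Import Order.TTheory GRing.Theory Num.Theory.
Local Open Scope classical_set_scope.
Local Open Scope ring_scope.

(** The increment of the mean optimal score between two neighbouring points of
    the lattice is a conditional mean drift of the transformation.  Write
    [drift K L z] for the mean gain of score when the state is [z], that is
    E[L(Z~) - L(Z) | Z = z].  Since the transformation carries the law of Z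
    given (U, V) = (u, v) to the law given (U, V) = (u + ko, v),

      l(u + ko, v) - l(u, v) = E[drift(Z) | U = u, V = v]

    ([meanUV_step]).  By (A1) the drift is at least eps outside of an event of
    probability at most exp(-n^alpha), and by (A2) it is almost surely at least
    -C ([drift_ge], [Pr_drift_lt]).  Conditioning on an event of probability at
    least 1/(a n) multiplies the probability of the exceptional event by at most
    a n, whence the increment is at least
    eps - (eps + |C|) a n exp(-n^alpha) ([Ex_given_ge]).  The subtracted term
    tends to 0, so for n large, uniformly in (u, v), it is at most eps / 2
    ([stretched_exp_small]).

    Two points u1 < u2 of the same lattice are joined by at least one step, all
    steps start inside the lattice, and each of them contributes at least
    eps / 2 > 0 ([lattice_increment]). *)

(** * Finite probability *)

Lemma sum_fst_eq (R : realType) (W : finType) (z : W) (F : W * W -> R) :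
  \sum_(s | s.1 == z) F s = \sum_w F (z, w).
Proof.
transitivity (\sum_(s : W * W | (s.1 == z) && true) F (s.1, s.2)).
  by apply: eq_big => [s|[s1 s2] _] //=; rewrite andbT.
rewrite -(pair_big (fun x => x == z) xpredT (fun x w => F (x, w))) /=.
by rewrite big_pred1_eq.
Qed.

Lemma iid_pair_law {R : realType} {T : finType} {p : T -> R} :
  is_law p -> is_law (iid_pair p).
Proof.
move=> [p0 p1]; split=> [t|]; first by apply: mulr_ge0.
rewrite /iid_pair -(pair_bigA _ (fun x y => p x * p y)) /=.
under eq_bigr => x _ do rewrite -mulr_sumr p1 mulr1.
by [].
Qed.

Lemma PrC {R : realType} {T : finType} {p : T -> R} (E : pred T) :
  is_law p -> Pr p (predC E) = 1 - Pr p E.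
Proof.
move=> [_ p1]; rewrite /Pr -p1 [X in _ = X - _](bigID E) /=.
by rewrite [X in _ = X - _]addrC addrK.
Qed.

Lemma Ex_givenE (R : realType) (T : finType) (p : T -> R) (f : T -> R)
    (E : pred T) :
  Ex_given p f E = (\sum_(t | E t) p t * f t) / Pr p E.
Proof.
rewrite /Ex_given /Ex /cond_law [X in _ = X / _]big_mkcond /= mulr_suml.
by apply: eq_bigr => t _; case: (E t); rewrite ?mul0r // mulrAC.
Qed.

(** The worst case for the conditional mean is that the whole exceptional event
    {f < e} lies inside the conditioning event; there f loses at most e + c
    compared with the value e. *)
Lemma Ex_given_ge {R : realType} {T : finType} {p : T -> R} (f : T -> R)
    (E : pred T) (e c : R) :
  (forall t, 0 <= p t) -> 0 < Pr p E -> 0 <= e + c ->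
  (forall t, 0 < p t -> - c <= f t) ->
  Ex_given p f E >= e - (e + c) * Pr p [pred t | f t < e] / Pr p E.
Proof.
move=> p0 E0 ec0 fc; rewrite Ex_givenE ler_pdivlMr // mulrBl divfK ?gt_eqF//.
have -> : (e + c) * Pr p [pred t | f t < e]
    = \sum_t p t * (if f t < e then e + c else 0).
  rewrite /Pr mulr_sumr big_mkcond /=; apply: eq_bigr => t _.
  by case: ifP; rewrite ?mulr0 // mulrC.
have exc0 t : 0 <= p t * (if f t < e then e + c else 0).
  by apply: mulr_ge0 => //; case: ifP.
apply: (@le_trans _ _ (\sum_(t | E t) p t * (e - (if f t < e then e + c else 0)))).
  under [leRHS]eq_bigr => t _ do rewrite mulrBr.
  rewrite sumrB -mulr_suml mulrC lerD2l lerN2 [leLHS]big_mkcond /=.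
  by apply: ler_sum => t _; case: ifP.
apply: ler_sum => t _.
have := p0 t; rewrite le_eqVlt => /predU1P[<-|pt]; first by rewrite !mul0r.
rewrite ler_pM2l //; case: ltP => [_|?]; last by rewrite subr0.
by rewrite opprD addNKr fc.
Qed.

(** * The drift of a random transformation *)

Definition drift {R : realType} {W : finType} (K : W -> W -> R) (L : W -> R)
  (z : W) : R := \sum_w K z w * (L w - L z).

Section Drift.
Variables (R : realType) (W : finType) (P : W -> R) (K : W -> W -> R).
Variable L : W -> R.
Hypotheses (P_law : is_law P) (K_kernel : is_kernel K).

Lemma Pr_joint_fst (E : pred W) :
  Pr (joint_law P K) [pred zz | E zz.1] = Pr P E.
Proof.
rewrite /Pr /joint_law; under eq_bigl => zz do rewrite -[_ zz]andbT.
rewrite -(pair_big E xpredT (fun z w => P z * K z w)) /=.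
by apply: eq_bigr => z _; rewrite -mulr_sumr (K_kernel z).2 mulr1.
Qed.

(** Given Z = z, the pair (Z, Z~) is (z, w) with probability [K z w].  On a null
    state the conditional expectation is 0 by convention and may differ from the
    drift. *)
Lemma cond_gain_drift (zz : W * W) : P zz.1 != 0 ->
  cond_Ex (joint_law P K) (score_gain L) fst zz = drift K L zz.1.
Proof.
move=> Pz0; rewrite /cond_Ex Ex_givenE (Pr_joint_fst (pred1 zz.1)).
rewrite sum_fst_eq /Pr big_pred1_eq /drift mulr_suml; apply: eq_bigr => w _.
by rewrite /joint_law /score_gain /= mulrAC [P _ * _]mulrC mulfK.
Qed.

(** (A1) is an event about the pair (Z, Z~), but a conditional expectation given
    Z depends on Z alone, so it can be read under the law of Z. *)
Lemma Pr_drift_lt (n : nat) (alpha e : R) : condA1 P K L n alpha e ->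
  Pr P [pred z | drift K L z < e] <= expR (- (n%:R `^ alpha)).
Proof.
rewrite /condA1 => A1.
have PrE : Pr P [pred z | e <= drift K L z] =
    Pr (joint_law P K)
       [pred zz | e <= cond_Ex (joint_law P K) (score_gain L) fst zz].
  rewrite -Pr_joint_fst /Pr [LHS]big_mkcond [RHS]big_mkcond /=.
  apply: eq_bigr => zz _.
  (* the two events may differ only on pairs of zero mass *)
  have [Pz0|Pz0] := eqVneq (P zz.1) 0; last by rewrite cond_gain_drift.
  by rewrite /joint_law Pz0 mul0r !if_same.
have -> : Pr P [pred z | drift K L z < e]
    = Pr P (predC [pred z | e <= drift K L z]).
  by apply: eq_bigl => z /=; rewrite ltNge.
by rewrite PrC // PrE lerBlDr addrC -lerBlDr.
Qed.

Lemma drift_ge (C : R) : condA2 P K L C ->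
  forall z, 0 < P z -> - C <= drift K L z.
Proof.
move=> A2 z Pz; have [K0 K1] := K_kernel z.
rewrite -[leLHS]mul1r -K1 mulr_suml; apply: ler_sum => w _.
have := K0 w; rewrite le_eqVlt => /predU1P[<-|Kw]; first by rewrite !mul0r.
by rewrite ler_pM2l //; apply: (A2 (z, w)); apply: mulr_gt0.
Qed.

(** The tower property, for an arbitrary initial law [p]. *)
Lemma Ex_transform_law (p : W -> R) :
  Ex (transform_law p K) L - Ex p L = Ex p (drift K L).
Proof.
have -> : Ex (transform_law p K) L = \sum_z \sum_w p z * (K z w * L w).
  rewrite /Ex /transform_law exchange_big; apply: eq_bigr => w _.
  by rewrite mulr_suml; apply: eq_bigr => z _; rewrite mulrA.
rewrite -sumrB; apply: eq_bigr => z _; rewrite -mulr_sumr -mulrBr /drift.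
under [in RHS]eq_bigr => w _ do rewrite mulrBr.
by rewrite sumrB -mulr_suml (K_kernel z).2 mul1r.
Qed.

Section Step.
Variables (d : nat) (U : W -> int) (V : W -> 'rV[int]_d) (k : nat).
Variables (Vs : set 'rV[int]_d) (Us : 'rV[int]_d -> set int).
Hypothesis A3 : condA3 P K U V k Vs Us.

(** By (A3), the mean of L at u + k is the mean of L(Z~) for Z distributed as
    at u. *)
Lemma meanUV_step (u : int) (v : 'rV[int]_d) : Vs v -> Us v u ->
  meanUV P U V L (u + k%:Z) v - meanUV P U V L u v
  = Ex_given P (drift K L) (evUV U V u v).
Proof.
move=> Vv Uu; have [_ tr] := A3 _ _ Vv Uu.
rewrite /meanUV /Ex_given -Ex_transform_law; congr (_ - _).
by apply: eq_bigr => z _; congr (_ * _); apply/esym/tr.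
Qed.

Lemma meanUV_step_ge (n : nat) (alpha e C a : R) (u : int) (v : 'rV[int]_d) :
  (0 < n)%N -> 0 < e -> 0 < a ->
  condA1 P K L n alpha e -> condA2 P K L C ->
  Vs v -> Us v u -> 1 / (a * n%:R) <= Pr P (evUV U V u v) ->
  meanUV P U V L (u + k%:Z) v - meanUV P U V L u v
  >= e - (e + `|C|) * a * (n%:R * expR (- (n%:R `^ alpha))).
Proof.
move=> n0 e0 a0 A1 A2 Vv Uu Ple.
have an0 : 0 < a * n%:R by rewrite mulr_gt0 ?ltr0n.
have PE0 : 0 < Pr P (evUV U V u v) by apply: lt_le_trans Ple; rewrite divr_gt0.
have eC0 : 0 <= e + `|C| by rewrite addr_ge0 // ltW.
rewrite meanUV_step //; apply: le_trans; last first.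
  apply: (Ex_given_ge _ _ e `|C| P_law.1) => // z Pz.
  by apply: le_trans (drift_ge _ A2 z Pz); rewrite lerN2 ler_norm.
(* it remains to see that P(drift < e) / P(E) is at most a n exp(-n^alpha) *)
rewrite lerD2l lerN2 -!mulrA ler_wpM2l // mulrA [leRHS]mulrC.
apply: ler_pM.
- by apply: sumr_ge0 => z _; apply: P_law.1.
- by rewrite invr_ge0 ltW.
- exact: Pr_drift_lt.
- by move: Ple; rewrite div1r -[X in _ <= X -> _]invrK lef_pV2 ?posrE ?invr_gt0.
Qed.

End Step.
End Drift.

(** * Asymptotics and telescoping *)

(** Raising [x / k <= expR (x / k)] to the power k gives
    [expR x >= (x / k) ^+ k]; at [x = n `^ alpha], an exponent k with
    [alpha * k >= 2] makes the right-hand side at least [n ^+ 2 / k ^+ k]. *)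
Lemma stretched_exp_small (R : realType) (alpha B e : R) :
  0 < alpha -> 0 <= B -> 0 < e ->
  exists N : nat, forall n : nat, (N < n)%N ->
    B * (n%:R * expR (- (n%:R `^ alpha))) <= e.
Proof.
move=> al0 B0 e0.
pose k := (Num.truncn (2 / alpha)).+1.
have k2 : 2 <= alpha * k%:R.
  by rewrite mulrC -ler_pdivrMr // ltW // truncnS_gt.
pose c : R := k%:R ^+ k.
have c0 : 0 < c by rewrite exprn_gt0 ?ltr0n.
exists (Num.truncn (B * c / e)).+1 => n Nn.
have n0 : 0 < n%:R :> R by rewrite ltr0n; apply: leq_ltn_trans Nn.
have n1 : 1 <= n%:R :> R by rewrite ler1n -(ltr0n R).
have BcN : B * c <= e * n%:R.
  rewrite [leRHS]mulrC -ler_pdivrMr //.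
  by apply: ltW; apply: lt_le_trans (truncnS_gt _) _; rewrite ler_nat ltnW.
have expn : n%:R ^+ 2 / c <= expR (n%:R `^ alpha).
  have -> : n%:R `^ alpha = k%:R * (n%:R `^ alpha / k%:R) :> R.
    by rewrite mulrC divfK ?pnatr_eq0.
  rewrite expRM_natl.
  apply: (@le_trans _ _ ((n%:R `^ alpha / k%:R) ^+ k)).
    rewrite expr_div_n -(powR_mulrn k (powR_ge0 _ _)) -powRrM.
    by rewrite ler_pM2r ?invr_gt0 // -(powR_mulrn 2 (ltW n0)) ler_powR.
  apply: lerXn2r; rewrite ?nnegrE ?divr_ge0 ?powR_ge0 ?expR_ge0 //.
  by apply: le_trans (expR_ge1Dx _); rewrite lerDr.
rewrite expRN.
apply: (@le_trans _ _ (B * (n%:R * (n%:R ^+ 2 / c)^-1))).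
  rewrite ler_wpM2l // ler_pM2l // lef_pV2 ?posrE ?expR_gt0 //.
  by rewrite divr_gt0 ?exprn_gt0.
rewrite invf_div [n%:R * _]mulrCA expr2 invfM mulVKf ?gt_eqF //.
by rewrite mulrA ler_pdivrMr.
Qed.

(** All steps from u1 up to u2 start at lattice points, the last one at u2 - k;
    one of them already gives e and the others are nonnegative. *)
Lemma lattice_increment (R : realType) (k : nat) (B : set int) (f : int -> R)
    (e : R) :
  is_lattice k B -> 0 <= e ->
  (forall u, B u -> e <= f (u + k%:Z) - f u) ->
  forall u1 u2, B u1 -> B u2 -> u1 < u2 -> e <= f u2 - f u1.
Proof.
move=> [u0 [m [_ ->]]] e0 step _ _ [i [/andP[i1 _] ->]] [j [/andP[_ jm] ->]].
rewrite ltrD2l ltz_nat => lt_ik_jk.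
have ij : (i < j)%N.
  rewrite ltnNge; apply: contraL lt_ik_jk => ji.
  by rewrite -leqNgt leq_mul2r ji orbT.
have {}step l : (i <= l < j)%N ->
    e <= f (u0 + (l.+1 * k)%N%:Z) - f (u0 + (l * k)%N%:Z).
  move=> /andP[il lj]; rewrite mulSn addnC PoszD addrA; apply: step.
  exists l; split=> //; rewrite (leq_trans i1 il) /=.
  exact: leq_trans (ltnW lj) jm.
rewrite -(telescope_sumr (fun l => f (u0 + (l * k)%N%:Z))) ?(ltnW ij) //.
rewrite big_ltn // -[leLHS]addr0 lerD ?step ?leqnn // big_nat_cond.
apply: sumr_ge0 => l /andP[/andP[il lj] _]; apply: le_trans e0 _.
by apply: step; rewrite lj ltnW.
Qed.

Theorem theorem2p2 (R : realType) (A : finType)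
    (X : forall n : nat, {set n.-tuple A})
    (mu : forall n : nat, seqs (X n) -> R)
    (S : A -> A -> R) (gamma : R) (d : nat)
    (U : forall n : nat, pairs (X n) -> int)
    (V : forall n : nat, pairs (X n) -> 'rV[int]_d)
    (ko : nat)
    (Vn : nat -> set 'rV[int]_d)
    (Un : nat -> 'rV[int]_d -> set int)
    (K : forall n : nat, pairs (X n) -> pairs (X n) -> R)
    (alpha eps C a : R)
    (mu_law : forall n : nat, (1 <= n)%N -> is_law (mu n))
    (S_ge0 : forall b c : A, 0 <= S b c)
    (ko_ge1 : (1 <= ko)%N)
    (Vn_sub : forall n : nat, (1 <= n)%N ->
      Vn n `<=` suppV (iid_pair (mu n)) (V n))
    (Un_sub : forall (n : nat) (v : 'rV[int]_d), (1 <= n)%N -> Vn n v ->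
      Un n v `<=` fiberU (iid_pair (mu n)) (U n) (V n) v)
    (Un_lattice : forall (n : nat) (v : 'rV[int]_d), (1 <= n)%N -> Vn n v ->
      is_lattice ko (Un n v))
    (K_kernel : forall n : nat, (1 <= n)%N -> is_kernel (K n))
    (alpha_gt0 : 0 < alpha) (eps_gt0 : 0 < eps) (a_gt0 : 0 < a)
    (A1 : forall n : nat, (1 <= n)%N ->
      condA1 (iid_pair (mu n)) (K n) (@Lscore R A n S gamma (X n)) n alpha eps)
    (A2 : forall n : nat, (1 <= n)%N ->
      condA2 (iid_pair (mu n)) (K n) (@Lscore R A n S gamma (X n)) C)
    (A3 : forall n : nat, (1 <= n)%N ->
      condA3 (iid_pair (mu n)) (K n) (U n) (V n) ko (Vn n) (Un n))
    (UV_lower : forall (n : nat) (v : 'rV[int]_d) (u : int), (1 <= n)%N ->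
      Vn n v -> Un n v u ->
      Pr (iid_pair (mu n)) (evUV (U n) (V n) u v) >= 1 / (a * n%:R)) :
  exists n5 : nat, forall n : nat, (n5 < n)%N ->
    forall v : 'rV[int]_d, Vn n v ->
    forall u1 u2 : int, Un n v u1 -> Un n v u2 -> u1 < u2 ->
      meanUV (iid_pair (mu n)) (U n) (V n) (@Lscore R A n S gamma (X n)) u2 v
      - meanUV (iid_pair (mu n)) (U n) (V n) (@Lscore R A n S gamma (X n)) u1 v
      >= eps / 2.
Proof.
have eC0 : 0 <= (eps + `|C|) * a by rewrite mulr_ge0 ?addr_ge0 // ltW.
have e20 : 0 < eps / 2 by rewrite divr_gt0.
have [N smallN] := stretched_exp_small _ _ _ _ alpha_gt0 eC0 e20.
exists N => n Nn v Vv.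
have n0 : (1 <= n)%N by apply: leq_ltn_trans Nn.
apply: (lattice_increment _ _ _
  (fun u => meanUV (iid_pair (mu n)) (U n) (V n)
              (@Lscore R A n S gamma (X n)) u v) _ (Un_lattice n v n0 Vv)).
  exact: ltW.
move=> u Uu.
apply: le_trans; last first.
  exact: (meanUV_step_ge _ _ _ _ _ (iid_pair_law (mu_law n n0)) (K_kernel n n0)
    _ _ _ _ _ _ (A3 n n0) _ _ _ _ _ _ _ n0 eps_gt0 a_gt0 (A1 n n0) (A2 n n0)
    Vv Uu (UV_lower n v u n0 Vv Uu)).
by rewrite lerBrDr -lerBrDl [X in X - _](splitr eps) addrK smallN.
Qed.
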